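(* For all $n\geq 1$ and $k\geq 0$, the number $b_{n,k}(213,312)$ of permutations $\pi\in\mathfrak{S}_n(213,312)$ with $\mathrm{bdes}(\pi)=k$ is $$b_{n,k}(213,312)=\binom{n}{2k+1}.$$
   Context: $\mathfrak{S}_n$ is the set of permutations $\pi=\pi_1\pi_2\cdots\pi_n$ of $[n]=\{1,\dots,n\}$ in one-line notation. $\mathfrak{S}_n(213,312)$ is the set of $\pi\in\mathfrak{S}_n$ having no length-three subsequence with the same relative order as $213$ or as $312$. An index $k\in[n-1]$ is a big descent of $\pi\in\mathfrak{S}_n$ if $\pi_k>\pi_{k+1}+1$; $\mathrm{bdes}(\pi)$ is the number of big descents of $\pi$. *)

(* Defs.v *)
From mathcomp Require Import all_boot all_fingroup.

Set Implicit Arguments.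
Unset Strict Implicit.
Unset Printing Implicit Defensive.

(* The word s_1 s_2 ... s_n, with letters in {1, ..., n}; since sequences are
   indexed from 0, s_k is nth 0 (one_line s) k.-1. *)
Definition one_line (n : nat) (s : 'S_n) : seq nat :=
  [seq (s i).+1 | i <- enum 'I_n].

(* f is the increasing choice of positions of a subsequence of w that has the
   same relative order as the word p. *)
Definition contains (p w : seq nat) : bool :=
  [exists f : {ffun 'I_(size p) -> 'I_(size w)},
    [forall i : 'I_(size p), forall j : 'I_(size p),
      (i < j) ==> (f i < f j)] &&
    [forall i : 'I_(size p), forall j : 'I_(size p),
      (nth 0 w (f i) < nth 0 w (f j)) == (nth 0 p i < nth 0 p j)]].

Definition avoiders (n : nat) (ps : seq (seq nat)) : {set 'S_n} :=
  [set s : 'S_n | all (fun p => ~~ contains p (one_line s)) ps].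

(* The index k in {1, ..., n - 1} is represented by i = k - 1 in 'I_n.-1. *)
Definition bdes (n : nat) (s : 'S_n) : nat :=
  #|[set i : 'I_n.-1 | nth 0 (one_line s) i > nth 0 (one_line s) i.+1 + 1]|.

Definition bdes_count (n k : nat) (ps : seq (seq nat)) : nat :=
  #|[set s in avoiders n ps | bdes s == k]|.

(* Main.v *)
Require Import Defs.
From mathcomp Require Import all_boot all_fingroup.
From mathcomp Require Import zify.

(** A permutation avoids 213 and 312 exactly when its word has no valley, i.e.
    no letter with larger letters on both sides.  The least letter of such a
    word is its first or its last one, and deleting it leaves a valley-free
    word, so the words of length n + 1 arise from those of length n by raising
    all letters and adding 1 in front or at the end.  Adding 1 in front keeps
    the number of big descents; adding it at the end creates one, unless the
    old word ended with its least letter.  Hence the numbers of words of length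
    n with k big descents that do, respectively do not, end with 1 satisfy
    Pascal's recurrence and are C(n - 1, 2k) and C(n - 1, 2k + 1). *)

Definition valley_free (w : seq nat) : Prop :=
  forall i j k, i < j -> j < k -> k < size w ->
    ~~ ((nth 0 w j < nth 0 w i) && (nth 0 w j < nth 0 w k)).

Definition word_bdes (w : seq nat) : nat :=
  count (fun i => nth 0 w i.+1 + 1 < nth 0 w i) (iota 0 (size w).-1).

(* The words have length n.+1. *)
Fixpoint unimodal_words (n : nat) : seq (seq nat) :=
  if n is m.+1 then
    [seq 1 :: map S w | w <- unimodal_words m] ++
    [seq rcons (map S w) 1 | w <- unimodal_words m]
  else [:: [:: 1]].

(** * Valley-free words and their recursive generation *)

Lemma nth_map_S w i : i < size w -> nth 0 (map S w) i = (nth 0 w i).+1.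
Proof. by move=> hi; rewrite (nth_map 0). Qed.

Lemma valley_free_map_S w : valley_free (map S w) <-> valley_free w.
Proof.
rewrite /valley_free size_map.
by split=> H i j k ij jk kw; have := H i j k ij jk kw; rewrite !nth_map_S //; lia.
Qed.

Lemma valley_free_cons x w : valley_free (x :: w) -> valley_free w.
Proof. by move=> H i j k ij jk kw; apply: (H i.+1 j.+1 k.+1). Qed.

Lemma valley_free_rcons w x : valley_free (rcons w x) -> valley_free w.
Proof.
move=> H i j k ij jk kw; have := H i j k ij jk.
rewrite size_rcons !nth_rcons kw (ltn_trans jk kw) (ltn_trans (ltn_trans ij jk) kw).
by apply; apply: ltnW.
Qed.

(** In a triple, the added 1 can only be an outer letter, and no raised letter lies below 1, so it
    creates no valley. The same holds for a 1 added at the end. *)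
Lemma cons_valley_free w : valley_free w -> valley_free (1 :: map S w).
Proof.
move/valley_free_map_S=> H [|i] [|j] [|k] //= ij jk; rewrite ltnS => kw.
  by rewrite nth_map_S //; move: kw; rewrite size_map; lia.
exact: H.
Qed.

Lemma rcons_valley_free w : valley_free w -> valley_free (rcons (map S w) 1).
Proof.
move/valley_free_map_S=> H i j k ij jk; rewrite size_rcons !nth_rcons => kw.
have jw : j < size (map S w) by lia.
rewrite jw (ltn_trans ij jw).
case: (ltnP k) => [kw0|wk]; first exact: H.
have -> : k == size (map S w) by lia.
by rewrite (nth_map_S w j); [lia | rewrite -(size_map S)].
Qed.

Lemma perm_cons_iota n w :
  perm_eq (1 :: map S w) (iota 1 n.+1) = perm_eq w (iota 1 n).
Proof.
rewrite /= perm_cons -[iota 2 n]/(iota (1 + 1) n) iotaDl.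
by apply/idP/idP => [/(perm_map_inj succn_inj)|/(perm_map S)].
Qed.

Lemma map_S_pred (w : seq nat) : 0 \notin w -> map S (map predn w) = w.
Proof.
by elim: w => //= x w IH; rewrite inE negb_or => /andP[x0 /IH ->]; rewrite prednK //; lia.
Qed.

Lemma mem_unimodal_words n w :
  w \in unimodal_words n <-> perm_eq w (iota 1 n.+1) /\ valley_free w.
Proof.
elim: n w => [|n IH] w.
  rewrite inE; split=> [/eqP ->|[/perm_small_eq -> //]].
  by split=> // i [|j] [|k].
rewrite [unimodal_words _]/= mem_cat; split.
  case/orP=> /mapP[v /IH[pv fv] ->]; split.
  - by rewrite perm_cons_iota.
  - exact: cons_valley_free.
  - by rewrite perm_rcons perm_cons_iota.
  - exact: rcons_valley_free.
case=> pw fw.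
have sw : size w = n.+2 by rewrite (perm_size pw) size_iota.
have uw : uniq w by rewrite (perm_uniq pw) iota_uniq.
have w1 : 1 \in w by rewrite (perm_mem pw) mem_iota.
have w0 : 0 \notin w by rewrite (perm_mem pw) mem_iota.
have iw : index 1 w < size w by rewrite index_mem.
have above i : i < size w -> i != index 1 w -> 1 < nth 0 w i.
  move=> hi; have := mem_nth 0 hi; case E: (nth 0 w i) => [|[|x]] //.
    by rewrite (negPf w0).
  by rewrite -E index_uniq // eqxx.
have [i0|ipos] := posnP (index 1 w).
  case: w => [|x v] // in pw fw sw uw w1 w0 iw above i0 *.
  have x1 : x = 1 by move: i0 => /=; case: eqP.
  rewrite x1 in pw fw w0 *.
  have v0 : 0 \notin v by move: w0; rewrite inE.
  apply/orP; left; apply/mapP; exists (map predn v); last by rewrite map_S_pred.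
  apply/IH; split; first by rewrite -perm_cons_iota map_S_pred.
  by apply/valley_free_map_S; rewrite map_S_pred //; apply: valley_free_cons fw.
(* A 1 strictly inside the word would form a valley with the first and the last letter, both of
   which exceed 1 by [above]. *)
have ilast : index 1 w = n.+1.
  apply/eqP/negPn/negP => ne.
  have lt : index 1 w < n.+1 by lia.
  have := fw 0 (index 1 w) n.+1 ipos lt; rewrite sw ltnSn nth_index // => /(_ isT).
  by rewrite (above 0) ?(above n.+1) ?sw //; lia.
case/lastP: w => [|v x] // in pw fw sw uw w1 w0 iw above ipos ilast *.
have sv : size v = n.+1 by move: sw; rewrite size_rcons => -[].
have x1 : x = 1.
  by have := nth_index 0 w1; rewrite ilast nth_rcons sv ltnn eqxx.
rewrite x1 in pw fw w0 *.
have v0 : 0 \notin v by move: w0; rewrite mem_rcons inE.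
apply/orP; right; apply/mapP; exists (map predn v); last by rewrite map_S_pred.
apply/IH; split; first by rewrite -perm_cons_iota map_S_pred // -perm_rcons.
by apply/valley_free_map_S; rewrite map_S_pred //; apply: valley_free_rcons fw.
Qed.

Lemma unimodal_words_size n w : w \in unimodal_words n -> size w = n.+1.
Proof. by case/mem_unimodal_words => /perm_size ->; rewrite size_iota. Qed.

Lemma unimodal_words_nth_gt0 n w i :
  w \in unimodal_words n -> i <= n -> 0 < nth 0 w i.
Proof.
move=> wU hi; have sw := unimodal_words_size n w wU.
case/mem_unimodal_words: wU => pw _.
have : nth 0 w i \in w by rewrite mem_nth // sw.
by rewrite (perm_mem pw) mem_iota => /andP[].
Qed.

(** The two families built at each step are disjoint: a word of the first starts with 1, one of the
    second with a raised letter, hence at least 2. *)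
Lemma unimodal_words_uniq n : uniq (unimodal_words n).
Proof.
elim: n => // n IH /=.
have inj1 : injective (fun w => 1 :: map S w).
  by move=> v w [] /(inj_map succn_inj).
have inj2 : injective (fun w => rcons (map S w) 1).
  by move=> v w /rcons_inj [] /(inj_map succn_inj).
rewrite cat_uniq !map_inj_uniq // IH !andbT.
apply/hasPn => _ /mapP[v vU ->]; apply/mapP => -[w _].
have := unimodal_words_nth_gt0 n v 0 vU (leq0n n).
by case: v vU => [|x v] vU //= x0 [] x1; lia.
Qed.

(** * Big descents and Pascal's recurrence *)

Lemma word_bdes_cons w : word_bdes (1 :: map S w) = word_bdes w.
Proof.
rewrite /word_bdes /= size_map; case sw: (size w) => [|m] //=.
rewrite nth_map_S ?sw // -[iota 1 m]/(iota (1 + 0) m) iotaDl count_map.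
have -> : (nth 0 w 0).+1 + 1 < 1 = false by lia.
apply: eq_in_count => i; rewrite mem_iota => /= im.
by rewrite !nth_map_S ?sw //; lia.
Qed.

Lemma word_bdes_rcons w : 0 < size w ->
  word_bdes (rcons (map S w) 1) = word_bdes w + (1 < last 0 w).
Proof.
rewrite /word_bdes size_rcons size_map /= -nth_last.
case sw: (size w) => [|m] // _.
(* The last index is split off: it compares the old last letter, raised, with the appended 1. *)
rewrite -[in iota 0 m.+1](addn1 m) iotaD count_cat /= addn0 add0n; congr (_ + _).
  apply: eq_in_count => i; rewrite mem_iota => /= im.
  rewrite !nth_rcons size_map sw !ifT; try lia.
  by rewrite !nth_map_S ?sw; lia.
by rewrite !nth_rcons size_map sw ltnn eqxx ltnSn nth_map_S ?sw // addn1 !ltnS.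
Qed.

Lemma count_andC T (a p : pred T) s :
  count a s = count (fun x => a x && p x) s + count (fun x => a x && ~~ p x) s.
Proof. by elim: s => //= x s ->; case: (a x); case: (p x) => /=; lia. Qed.

(** Let A(n, k) and B(n, k) be the two counts. They are treated together because A(n + 1, k) = A(n,
    k) + B(n, k - 1), where the last term is 0 for k = 0, and B(n + 1, k) = A(n, k) + B(n, k). The
    product of the two equations lets [rewrite] pick either one. *)
Lemma count_last1_unimodal_words n k :
  (count (fun w => (word_bdes w == k) && (last 0 w == 1)) (unimodal_words n)
     = 'C(n, 2 * k)) *
  (count (fun w => (word_bdes w == k) && (last 0 w != 1)) (unimodal_words n)
     = 'C(n, 2 * k + 1)).
Proof.
elim: n k => [|n IH] k; first by case: k => [|k] //=; rewrite mulnS !bin0n.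
have szp w : w \in unimodal_words n -> 0 < size w.
  by move/unimodal_words_size ->.
have lastp w : w \in unimodal_words n -> 0 < last 0 w.
  move=> wU; rewrite -nth_last (unimodal_words_size n w) //.
  exact: unimodal_words_nth_gt0 wU _.
(* The default is 1 because [last 0 (1 :: map S w)] reduces to [last 1 (map S w)]. *)
have last1 w : w \in unimodal_words n -> last 1 (map S w) = (last 0 w).+1.
  by move/szp; case: w => //= x w _; rewrite last_map.
split; rewrite /= count_cat !count_map.
  rewrite (eq_in_count (a2 := pred0)); last first.
    by move=> w wU /=; rewrite last1 //; have := lastp w wU; lia.
  (* Only words with an appended 1 remain. They are split by whether the old word ended with 1, in
     which case the count of big descents stays, or not, in which case it grows by one. *)
  rewrite count_pred0 add0n (count_andC _ _ (fun w => last 0 w == 1)).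
  rewrite (eq_in_count
    (a2 := fun w => (word_bdes w == k) && (last 0 w == 1))); last first.
    move=> w wU /=; rewrite word_bdes_rcons ?szp // last_rcons eqxx andbT.
    by case: (last 0 w =P 1) => [->|_]; rewrite ?andbF // addn0.
  rewrite [X in _ + X](eq_in_count
    (a2 := fun w => (word_bdes w + 1 == k) && (last 0 w != 1))); last first.
    move=> w wU /=; rewrite word_bdes_rcons ?szp // last_rcons eqxx andbT.
    by have := lastp w wU; case: (ltngtP 1 (last 0 w)); rewrite ?andbF.
  rewrite IH; case: k => [|k].
    rewrite muln0 !bin0 (eq_count (a2 := pred0)) ?count_pred0 //.
    by move=> w /=; rewrite addn1.
  rewrite (eq_count (a2 := fun w => (word_bdes w == k) && (last 0 w != 1))).
    by rewrite IH mulnS add2n binS addn1.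
  by move=> w /=; rewrite addn1 eqSS.
(* Here only words with a prepended 1 contribute: they never end with 1, whatever the ending of the
   old word. *)
rewrite (eq_in_count (a2 := fun w => word_bdes w == k)); last first.
  by move=> w wU /=; rewrite last1 // word_bdes_cons eqSS -lt0n lastp // andbT.
rewrite [X in _ + X](eq_in_count (a2 := pred0)); last first.
  by move=> w wU /=; rewrite last_rcons eqxx andbF.
rewrite count_pred0 addn0 (count_andC _ _ (fun w => last 0 w == 1)) !IH.
by rewrite addn1 binS addnC.
Qed.

Lemma count_unimodal_words n k :
  count (fun w => word_bdes w == k) (unimodal_words n) = 'C(n.+1, 2 * k + 1).
Proof.
rewrite (count_andC _ _ (fun w => last 0 w == 1)) !count_last1_unimodal_words.
by rewrite addn1 binS addnC.
Qed.

(** * Permutations as words *)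

Section OneLine.

Variable n : nat.
Implicit Type s : 'S_n.

Lemma size_one_line s : size (one_line s) = n.
Proof. by rewrite size_map size_enum_ord. Qed.

Lemma nth_one_line s (i : 'I_n) : nth 0 (one_line s) i = (s i).+1.
Proof. by rewrite (nth_map i) ?size_enum_ord // nth_ord_enum. Qed.

Lemma one_line_inj : injective (@one_line n).
Proof.
move=> s t st; apply/permP => i; apply/val_inj/succn_inj.
by rewrite -!nth_one_line st.
Qed.

Lemma one_line_uniq s : uniq (one_line s).
Proof.
by rewrite map_inj_uniq ?enum_uniq // => i j [] /val_inj /perm_inj.
Qed.

Lemma perm_one_line s : perm_eq (one_line s) (iota 1 n).
Proof.
apply: uniq_perm; rewrite ?one_line_uniq ?iota_uniq //.
have sub : {subset one_line s <= iota 1 n}.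
  by move=> x /mapP[i _ ->]; rewrite mem_iota /= add1n ltnS ltn_ord.
have [|_ //] := uniq_min_size (one_line_uniq s) sub.
by rewrite size_iota size_one_line.
Qed.

(** The map sending [i] to the letter at [i] minus one is injective because [w] has no repeated
    letter. *)
Lemma one_line_surj w : perm_eq w (iota 1 n) -> exists s : 'S_n, one_line s = w.
Proof.
move=> pw.
have sw : size w = n by rewrite (perm_size pw) size_iota.
have uw : uniq w by rewrite (perm_uniq pw) iota_uniq.
have bound (i : 'I_n) : 0 < nth 0 w i < n.+1.
  by have := mem_nth 0 (_ : i < size w); rewrite sw (perm_mem pw) mem_iota; apply.
have predlt (i : 'I_n) : (nth 0 w i).-1 < n by have := bound i; lia.
have inj : injective (fun i => Ordinal (predlt i)).
  move=> i j [] e; apply/ord_inj/eqP; rewrite -(nth_uniq 0 _ _ uw) ?sw //.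
  case/andP: (bound i) => i0 _; case/andP: (bound j) => j0 _.
  by rewrite -(prednK i0) -(prednK j0) e.
exists (perm inj); apply: (@eq_from_nth _ 0); rewrite size_one_line ?sw // => i hi.
rewrite (nth_one_line _ (Ordinal hi)) permE /= prednK //.
by have /andP[] := bound (Ordinal hi).
Qed.

Lemma bdes_word s : bdes s = word_bdes (one_line s).
Proof.
rewrite /bdes /word_bdes size_one_line -sum1_card -sum1_count.
rewrite -[in iota 0 _](subn0 n.-1) -/(index_iota 0 _) big_mkord.
by apply: eq_bigl => i; rewrite inE.
Qed.

End OneLine.

(** * Pattern avoidance as absence of valleys, and the final count *)

(** This trades the function on ordinals for three explicit positions. The comparisons stay indexed
    by [x] and [y], so that a single one can be extracted by instantiation. *)
Lemma contains3P (a b c : nat) (w : seq nat) :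
  reflect (exists i j k, [/\ i < j, j < k, k < size w &
     forall x y, x < 3 -> y < 3 ->
      (nth 0 w (nth 0 [:: i; j; k] x) < nth 0 w (nth 0 [:: i; j; k] y)) =
      (nth 0 [:: a; b; c] x < nth 0 [:: a; b; c] y)])
    (contains [:: a; b; c] w).
Proof.
apply: (iffP existsP) => [[f /andP[/forallP mono /forallP ord]]|].
  pose o0 := @Ordinal 3 0 isT; pose o1 := @Ordinal 3 1 isT.
  pose o2 := @Ordinal 3 2 isT.
  have fo x (hx : x < 3) :
    nth 0 [:: f o0 : nat; f o1 : nat; f o2 : nat] x = f (Ordinal hx).
    by case: x hx => [|[|[|x]]] //= hx; congr (nat_of_ord (f _)); apply: val_inj.
  exists (f o0), (f o1), (f o2); split=> //.
  - by have /forallP/(_ o1)/implyP := mono o0; apply.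
  - by have /forallP/(_ o2)/implyP := mono o1; apply.
  move=> x y hx hy; rewrite !fo.
  by have /forallP/(_ (Ordinal hy))/eqP := ord (Ordinal hx).
move=> [i [j [k [ij jk kw H]]]].
have lt (x : 'I_3) : nth 0 [:: i; j; k] x < size w.
  by case: x => [[|[|[|x]]]] //= _; lia.
exists [ffun x => Ordinal (lt x)]; apply/andP; split.
  apply/forallP => x; apply/forallP => y; rewrite !ffunE /=.
  by case: x y => [[|[|[|x]]]] // hx [[|[|[|y]]]] //= hy; lia.
apply/forallP => x; apply/forallP => y; rewrite !ffunE /= H //.
Qed.

(** The outer letters of a valley differ since [w] is duplicate-free, and their order decides
    between 213 and 312. Conversely, both patterns have their least letter in the middle. *)
Lemma avoids_valley_free w : uniq w ->
  all (fun p => ~~ contains p w) [:: [:: 2; 1; 3]; [:: 3; 1; 2]] <->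
  valley_free w.
Proof.
move=> uw; rewrite /= andbT; split=> [/andP[n213 n312] i j k ij jk kw|vf].
  apply/negP => /andP[ji jk'].
  have ik := ltn_trans ij jk.
  have nik : nth 0 w i != nth 0 w k.
    by rewrite nth_uniq // ?neq_ltn ?ik // (ltn_trans ik).
  case: (ltngtP (nth 0 w i) (nth 0 w k)) nik => // lt_ik _.
    move/negP: n213; apply; apply/contains3P; exists i, j, k; split=> //.
    by move=> [|[|[|x]]] [|[|[|y]]] //= _ _; lia.
  move/negP: n312; apply; apply/contains3P; exists i, j, k; split=> //.
  by move=> [|[|[|x]]] [|[|[|y]]] //= _ _; lia.
apply/andP; split; apply/negP => /contains3P[i [j [k [ij jk kw H]]]].
  by have /negP[] := vf i j k ij jk kw; rewrite (H 1 0) // (H 1 2).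
by have /negP[] := vf i j k ij jk kw; rewrite (H 1 0) // (H 1 2).
Qed.

Theorem theorem3p3 (n k : nat) (hn : 1 <= n) :
  bdes_count n k [:: [:: 2; 1; 3]; [:: 3; 1; 2]] = 'C(n, 2 * k + 1).
Proof.
case: n hn => // n _; rewrite -count_unimodal_words /bdes_count.
set A := [set s in _ | _].
(* Both sides become sizes of duplicate-free lists of words, so it suffices that these lists have
   the same members. *)
rewrite cardE -(size_map (@one_line n.+1)) -size_filter.
apply/perm_size/uniq_perm.
- by rewrite (map_inj_uniq (@one_line_inj _)) enum_uniq.
- by rewrite filter_uniq // unimodal_words_uniq.
move=> w; rewrite mem_filter; apply/mapP/andP => [[s]|[/eqP bw]].
  rewrite mem_enum !inE bdes_word => /andP[avs bs] ->; split=> //.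
  apply/mem_unimodal_words; split; first exact: perm_one_line.
  exact/(avoids_valley_free _ (one_line_uniq _ s)).
case/mem_unimodal_words => /one_line_surj[s sw] vf; exists s => //.
rewrite mem_enum !inE bdes_word sw bw eqxx andbT.
by apply/avoids_valley_free; rewrite // -sw one_line_uniq.
Qed.
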